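(* Let $X$ and $Y$ be nonempty Polish spaces with $X$ perfect, and let $A$ be a dense $G_\delta$ subset of $X\times Y$. Then there exist a dense $G_\delta$ subset $F$ of $X$, a dense $G_\delta$ subset $G$ of $Y$, and a continuous open surjection $f:F\to G$ whose graph is contained in $A$; moreover, $F$ can be taken homeomorphic to $\omega^\omega$.
   Context: Perfect means without isolated points. $\omega^\omega$ is the Baire space. *)

(* Defs.v *)
From HB Require Import structures.
From mathcomp Require Import all_boot all_order all_algebra.
From mathcomp Require Import all_classical all_reals all_analysis.
From mathcomp Require Import borel_hierarchy.

Set Implicit Arguments.
Unset Strict Implicit.
Unset Printing Implicit Defensive.

Import Order.TTheory GRing.Theory Num.Theory.
Import numFieldNormedType.Exports.

Local Open Scope classical_set_scope.
Local Open Scope ring_scope.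

Definition is_metric (R : realType) (T : Type) (d : T -> T -> R) : Prop :=
  [/\ forall x y, 0 <= d x y,
      forall x y, d x y = 0 <-> x = y,
      forall x y, d x y = d y x &
      forall x y z, d x z <= d x y + d y z].

(* The neighborhoods of [T] are exactly those generated by the open [d]-balls. *)
Definition induces_topology (R : realType) (T : topologicalType)
    (d : T -> T -> R) : Prop :=
  forall x : T, nbhs x = nbhs_ball_ (fun a e => [set b | d a b < e]) x.

Definition cauchy_seq (R : realType) (T : Type) (d : T -> T -> R)
    (u : nat -> T) : Prop :=
  forall e : R, 0 < e ->
    exists N : nat, forall m n : nat, (N <= m)%N -> (N <= n)%N ->
      d (u m) (u n) < e.

Definition completely_metrizable (R : realType) (T : topologicalType) : Prop :=
  exists d : T -> T -> R,
    [/\ is_metric d,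
        induces_topology d &
        forall u : nat -> T, cauchy_seq d u -> exists l : T, u @ \oo --> l].

Definition separable (T : topologicalType) : Prop :=
  exists D : set T, countable D /\ dense D.

(* The empty space is Polish under this definition. *)
Definition polish (R : realType) (T : topologicalType) : Prop :=
  separable T /\ completely_metrizable R T.

Definition perfect_space (T : topologicalType) : Prop :=
  isolated [set: T] = set0.

Definition dense_Gdelta (T : topologicalType) (S : set T) : Prop :=
  dense S /\ Gdelta S.

Definition open_map (T U : topologicalType) (f : T -> U) : Prop :=
  forall V : set T, open V -> open (f @` V).

Definition homeomorphic (T U : topologicalType) : Prop :=
  exists (f : T -> U) (g : U -> T),
    [/\ continuous f, continuous g, cancel f g & cancel g f].

(* The topology on [nat] is the discrete one, and [{ptws nat -> nat}] carries
   the product topology. *)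
Definition baire_space : topologicalType := {ptws nat -> nat}.

(* Main.v *)
Require Import Defs.
From mathcomp Require Import all_boot all_order all_algebra.
From mathcomp Require Import all_classical all_reals all_analysis.
From mathcomp Require Import lra.

Set Implicit Arguments.
Unset Strict Implicit.
Unset Printing Implicit Defensive.

Import Order.TTheory GRing.Theory Num.Theory.

Local Open Scope classical_set_scope.

(** The finite sequences [s] of naturals index a tree of pairs [(U s, V s)] of
    nonempty open sets of [X] and [Y], starting from the whole spaces.
    Write [A] as the intersection of dense open sets [A_ n].  The children of a
    node [s] of length [n] have closures inside [U s] and [V s], shrink with
    [n], and satisfy [U (k :: s) `*` V (k :: s) `<=` A_ n]; the
    sets [U (k :: s)] are pairwise disjoint with union dense in [U s], and the
    union of the sets [V (k :: s)] is dense in [V s] ([splitting_exists]; this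
    is where perfectness of [X] is used).  Each branch [a] then determines a
    point [p a] of [X] and a point [q a] of [Y] with [A (p a, q a)].  The set
    [F] of all [p a] is the intersection of the levels of the tree, a dense
    G-delta set, and [p] is a homeomorphism from the Baire space onto it because
    the sets [U] are disjoint on each level.  The map is [f (p a) = q a].

    Openness of [f] asks for [f (F `&` U s) = G `&` V s], that is, for every
    point of [G `&` V s] to lie in some [V (k :: s)].  The points of [V s] that
    the children miss form a nowhere dense set, so a dense G-delta set [G]
    avoids them for all [s] at once; but the values of [f] have to lie in [G]
    too.  The sets [V] of a late node are therefore also kept inside the dense
    open sets attached to the earlier nodes: level [n] is confined to the finite
    intersection [allowed n] of these, and [G] is the intersection of all the
    [allowed n] ([node_splitting], [node_cover]).  Confining each level by
    finitely many conditions keeps the constraint open and dense, and each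
    condition still applies from some level on. *)

(** * Shrinking sequences of open sets in Polish spaces *)

(** The consequence of complete metrizability that the construction uses,
    freed from the metric: [small n] stands for having diameter less than
    [1 / n.+1], and the second clause is Cantor's intersection theorem. *)
Definition shrinking (T : topologicalType) (small : nat -> set (set T)) :=
  (forall n (W : set T) x, open W -> W x ->
     exists B : set T, [/\ open B, B x, closure B `<=` W & small n B]) /\
  (forall S : nat -> set T, (forall n, S n !=set0) ->
     (forall n, closure (S n.+1) `<=` S n) -> (forall n, small n (S n.+1)) ->
     exists x, (forall n, S n x) /\
       forall W, nbhs x W -> exists n, S n `<=` W).

(** Empty members are allowed, so that a sequence can always be used. *)
Definition pi_base (T : topologicalType) (C : nat -> set T) :=
  (forall k, open (C k)) /\
  (forall W : set T, open W -> W !=set0 -> exists k, C k !=set0 /\ C k `<=` W).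

Section Metric.
Local Open Scope ring_scope.
Variables (R : realType) (T : topologicalType) (d : T -> T -> R).
Hypotheses (dm : is_metric d) (dt : induces_topology d).

Let dist0 x : d x x = 0.
Proof. by case: dm => _ /(_ x x) [_ ->]. Qed.

Let dist_sym x y : d x y = d y x.
Proof. by case: dm. Qed.

Let dist_triangle x y z : d x z <= d x y + d y z.
Proof. by case: dm. Qed.

Lemma metric_nbhsP x (W : set T) :
  nbhs x W <-> exists2 e, 0 < e & forall y, d x y < e -> W y.
Proof.
rewrite dt; split => [[e /= e0 eW]|[e e0 eW]]; exists e => //.
Qed.

Lemma metric_open_ball x e : open [set y | d x y < e].
Proof.
rewrite openE => y /= dxy; apply/metric_nbhsP; exists (e - d x y).
  by rewrite subr_gt0.
move=> z dyz /=; have := dist_triangle x y z; lra.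
Qed.

Lemma metric_accessible : accessible_space T.
Proof.
move=> x y xy; exists [set z | d x z < d x y].
have dxy : 0 < d x y.
  rewrite lt_neqAle; case: dm => -> dE _ _; rewrite andbT eq_sym.
  by apply/eqP => /dE /eqP; rewrite (negbTE xy).
split; first exact: metric_open_ball.
  by apply/mem_set; rewrite /= dist0.
by apply/mem_set; rewrite /= ltxx.
Qed.

Lemma metric_closure_ball x e y :
  closure [set z | d x z < e] y -> d x y <= e.
Proof.
move=> cy; rewrite leNgt; apply/negP => ey.
have [|z [/= dxz dyz]] := cy [set z | d y z < d x y - e].
  apply: open_nbhs_nbhs; split; first exact: metric_open_ball.
  by rewrite /= dist0 subr_gt0.
have := dist_triangle x z y; rewrite (dist_sym z y); lra.
Qed.

Definition diam_lt (n : nat) : set (set T) :=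
  [set B | forall x y, B x -> B y -> d x y < n.+1%:R^-1].

(** Points picked in the successive sets form a Cauchy sequence; its limit lies
    in each set since it lies in the closure of the next one. *)
Lemma metric_shrinking :
  (forall u, cauchy_seq d u -> exists l : T, u @ \oo --> l) ->
  shrinking diam_lt.
Proof.
move=> dc; split=> [n W x oW Wx|S S0 Scl Sd].
  have [e e0 eW] : exists2 e, 0 < e & forall y, d x y < e -> W y.
    by apply/metric_nbhsP; apply: open_nbhs_nbhs.
  have n0 : 0 < n.+1%:R^-1 :> R by rewrite invr_gt0.
  rewrite /diam_lt; move: (n.+1%:R^-1) n0 => a a0 /=.
  pose r := Num.min (e / 2) (a / 2).
  have r0 : 0 < r by rewrite lt_min; apply/andP; split; lra.
  have re : r < e.
    by apply: (@le_lt_trans _ _ (e / 2)); [rewrite ge_min lexx|lra].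
  have rn : r <= a / 2 by rewrite ge_min lexx orbT.
  exists [set y | d x y < r]; split.
  - exact: metric_open_ball.
  - by rewrite /= dist0.
  - by move=> y /metric_closure_ball yr; apply: eW; exact: le_lt_trans re.
  - move=> y z /= dxy dxz; have := dist_triangle y x z.
    rewrite (dist_sym y x); lra.
have Smono m n : (m <= n)%N -> S n `<=` S m.
  move=> /subnK <-; elim: (n - m)%N => // k IH.
  by rewrite addSn => z Sz; apply/IH/Scl/subset_closure.
have /choice [u uS] := S0.
have [|l ul] := dc u.
  move=> e e0; have [N Ne] : exists N : nat, N.+1%:R^-1 < e.
    have [N _ /(_ N (leqnn N)) /=] := near_infty_natSinv_lt (PosNum e0).
    by exists N.
  exists N.+1 => m n Nm Nn; apply: lt_trans Ne.
  by apply: (Sd N); [exact: Smono Nm _ _|exact: Smono Nn _ _].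
have Sl n : S n l.
  apply: Scl => W /ul [N _ NW]; exists (u (maxn N n.+1)); split.
    by apply: (Smono n.+1 (maxn N n.+1)); rewrite ?leq_maxr.
  by apply: NW; rewrite /= leq_maxl.
exists l; split => // W /metric_nbhsP [e e0 eW].
have [N _ /(_ N (leqnn N)) /= Ne] := near_infty_natSinv_lt (PosNum e0).
exists N.+1 => y Sy; apply: eW; apply: lt_trans Ne.
by apply: (Sd N).
Qed.

(** Balls of radius [1 / m.+1] around the points of a countable dense set.  The
    points are designated by their image under an injection into [nat], hence
    the union over a fibre, which has at most one element. *)
Lemma metric_pi_base : separable T -> exists C : nat -> set T, pi_base C.
Proof.
move=> [D [/countable_injP [f finj] dD]].
pose c k : nat * nat := odflt (0%N, 0%N) (unpickle k).
exists (fun k => \bigcup_(x in D `&` [set x | f x = (c k).1])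
  [set y | d x y < (c k).2.+1%:R^-1]); split.
  by move=> k; apply: bigcup_open => x _; exact: metric_open_ball.
move=> W oW [w Ww].
have [e e0 eW] : exists2 e, 0 < e & forall y, d w y < e -> W y.
  by apply/metric_nbhsP; apply: open_nbhs_nbhs.
have e20 : 0 < e / 2 by lra.
have [N _ /(_ N (leqnn N)) /= Ne] := near_infty_natSinv_lt (PosNum e20).
have N0 : 0 < N.+1%:R^-1 :> R by rewrite invr_gt0.
have [|x [/= wx Dx]] := dD _ _ (@metric_open_ball w (N.+1%:R^-1)).
  by exists w; rewrite /= dist0.
exists (pickle (f x, N)); rewrite /c pickleK /=; split.
  by exists x, x => //=; rewrite dist0.
move=> y [x' [Dx' fx']] /= x'y; apply: eW.
have {fx'}xE : x' = x by apply: finj => //; exact: mem_set.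
rewrite xE in x'y; have := dist_triangle w x y.
move: Ne wx x'y; move: (N.+1%:R^-1) => a; lra.
Qed.

End Metric.

Lemma polish_shrinking (R : realType) (T : topologicalType) : polish R T ->
  [/\ accessible_space T, exists small, @shrinking T small &
      exists C, @pi_base T C].
Proof.
move=> [sT [d [dm dt dc]]]; split; first exact: metric_accessible dt.
  by exists (diam_lt d); exact: metric_shrinking.
exact: metric_pi_base dt _.
Qed.

(** * The Baire category theorem *)

Section Baire.
Variable T : topologicalType.

Lemma dense_bigcap_lt (D : nat -> set T) n :
  (forall j, open (D j)) -> (forall j, dense (D j)) ->
  open (\bigcap_(j < n) D j) /\ dense (\bigcap_(j < n) D j).
Proof.
move=> oD dD; elim: n => [|n [oI dI]].
  rewrite bigcap_mkord big_ord0; split; first exact: openT.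
  by move=> W [w Ww] _; exists w.
rewrite bigcap_mkord big_ord_recr /= -bigcap_mkord; split; first exact: openI.
exact: denseI.
Qed.

(** A nested sequence of small open sets starting in [W], the next one inside
    [D n] at step [n], shrinks to a point of [W] in all the [D n]. *)
Lemma shrinking_baire small (sm : @shrinking T small) (D : nat -> set T) :
  (forall n, open (D n)) -> (forall n, dense (D n)) -> dense (\bigcap_n D n).
Proof.
move: sm => [smP smC] oD dD W W0 oW.
have : forall p : nat * set T, exists B : set T, open p.2 -> p.2 !=set0 ->
    [/\ open B, B !=set0, closure B `<=` p.2 `&` D p.1 & small p.1 B].
  move=> [n S] /=.
  have [oS|?] := pselect (open S); last by exists set0.
  have [S0|?] := pselect (S !=set0); last by exists set0.
  have [x SDx] := dD n _ S0 oS.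
  have [B [oB Bx clB sB]] := smP n _ _ (openI oS (oD n)) SDx.
  by exists B => _ _; split=> //; exists x.
move=> /choice [h hP].
pose S := fix S n := if n is m.+1 then h (m, S m) else W.
have SP n : open (S n) /\ S n !=set0.
  by elim: n => //= n [oS S0]; have [] := hP (n, S n) oS S0.
have hS n := hP (n, S n) (SP n).1 (SP n).2.
have [||n|x [xS _]] := smC S.
- by move=> n; case: (SP n).
- by move=> n; have [_ _ h1 _] := hS n => z /h1 [].
- by have [] := hS n.
exists x; split; first exact: (xS 0%N).
move=> n _; have [_ _ h1 _] := hS n.
by have [] := h1 _ (subset_closure (xS n.+1)).
Qed.

End Baire.

(** * Splitting an open box *)

Section Split.
Variables (X Y : topologicalType).
Implicit Types (p : set X * set Y) (c : nat -> set X * set Y).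

Definition open_box p := [/\ open p.1, p.1 !=set0, open p.2 & p.2 !=set0].

(** The requirements on the children [c] of a node [p]; the last two say that the
    union of the [(c k).1] is dense in [p.1] and that of the [(c k).2] in [p.2],
    in the form in which they are used. *)
Definition splitting (smX : set (set X)) (smY : set (set Y))
    (O : set (X * Y)) (E : set Y) p c :=
  [/\ forall k, [/\ open_box (c k), (c k).1 `*` (c k).2 `<=` O,
                    closure (c k).1 `<=` p.1 & closure (c k).2 `<=` p.2 `&` E],
      forall k, smX (c k).1 /\ smY (c k).2,
      forall j k x, (c j).1 x -> (c k).1 x -> j = k,
      forall W, open W -> W `&` p.1 !=set0 -> exists k, W `&` (c k).1 !=set0 &
      forall W, open W -> W `&` p.2 !=set0 -> exists k, W `&` (c k).2 !=set0].

Lemma open_setX (U : set X) (V : set Y) : open U -> open V -> open (U `*` V).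
Proof.
move=> oU oV; rewrite openE => -[x y] [/= Ux Vy]; exists (U, V) => //=.
by split; apply: open_nbhs_nbhs.
Qed.

Lemma perfect_other_point (Z : set X) x : perfect_space X ->
  open Z -> Z x -> exists2 x', Z x' & x' <> x.
Proof.
move=> pX oZ Zx; apply: contrapT => noZ.
suff : isolated [set: X] x by rewrite pX.
split; first exact: mem_set.
exists Z; first exact: open_nbhs_nbhs.
rewrite setIT; apply/seteqP; split => z /=; last by move->.
by move=> Zz; apply: contrapT => zx; apply: noZ; exists z.
Qed.

Variables (smX : nat -> set (set X)) (smY : nat -> set (set Y)).
Hypotheses (shX : shrinking smX) (shY : shrinking smY).
Hypotheses (aX : accessible_space X) (pX : perfect_space X).

(** Around a point of [O] in [Z `*` V], with a second point of [Z] kept off the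
    closure: what remains of [Z] is again nonempty and open, so that a further
    box can be placed there. *)
Lemma small_box n (O : set (X * Y)) (Z : set X) (V : set Y) :
  open O -> dense O -> open Z -> Z !=set0 -> open V -> V !=set0 ->
  exists q, [/\ open_box q, q.1 `*` q.2 `<=` O,
    smX n q.1 /\ smY n q.2, closure q.1 `<=` Z /\ closure q.2 `<=` V &
    (Z `\` closure q.1) !=set0].
Proof.
move=> oO dO oZ [z Zz] oV [v Vv].
have [|[x y] [[/= Zx Vy] Oxy]] := dO _ _ (open_setX oZ oV).
  by exists (z, v).
have [x' Zx' xx'] := perfect_other_point pX oZ Zx.
have [[N M] /= [nN nM] NMO] : nbhs (x, y) O by apply: open_nbhs_nbhs.
have cx' : open (~` [set x']).
  by rewrite openC; exact: accessible_closed_set1.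
have [||B [oB Bx clB sB]] := shX.1 n ((Z `&` N°) `&` ~` [set x']) x.
- by apply: openI => //; apply: openI => //; exact: open_interior.
- by split=> [//|/= /esym].
have [||C [oC Cy clC sC]] := shY.1 n (V `&` M°) y.
- by apply: openI => //; exact: open_interior.
- by [].
exists (B, C); split => //=.
- by split=> //; [exists x|exists y].
- move=> [a b] /= [/subset_closure/clB [[_ Na] _]].
  move=> /subset_closure/clC [_ Mb].
  by apply: NMO; split => /=; exact: interior_subset.
- by split; [move=> a /clB [[]]|move=> b /clC []].
- by exists x'; split => // /clB [_]; apply.
Qed.

Variables (CX : nat -> set X) (CY : nat -> set Y).
Hypotheses (bX : pi_base CX) (bY : pi_base CY).

(** Boxes are placed one after the other, the [k]-th one over the part [Z k] of
    [p.1] that the closures of the previous ones leave free.  It is put inside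
    the [k]-th basic set whenever that set meets the free part, which makes the
    first projections dense: a basic set inside [p.1] that no box meets would be
    free at every step, in particular at the step devoted to it.  On the side
    of [Y] overlaps are permitted, and the [k]-th box goes into the [k]-th basic
    set whenever this meets [p.2 `&` E]. *)
Lemma splitting_exists n (O : set (X * Y)) (E : set Y) p :
  open O -> dense O -> open E -> dense E -> open_box p ->
  exists c, splitting (smX n) (smY n) O E p c.
Proof.
case: p => U V oO dO oE dE [/= oU U0 oV V0].
pose or_else T (S S' : set T) := if pselect (S !=set0) then S else S'.
have or_else0 T (S S' : set T) : S' !=set0 -> or_else T S S' !=set0.
  by rewrite /or_else; case: pselect.
have or_elseO (T : topologicalType) (S S' : set T) :
    open S -> open S' -> open (or_else T S S').
  by rewrite /or_else; case: pselect.
(* The box number [k] is sought in [target k (Z k) `*` targetY k]. *)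
pose target k Z := or_else X (CX k `&` Z) Z.
pose targetY k := or_else Y (CY k `&` (V `&` E)) (V `&` E).
have VE0 : V `&` E !=set0 by exact: dE.
have oVE : open (V `&` E) by exact: openI.
have targetYS k : targetY k `<=` V `&` E.
  by rewrite /targetY /or_else; case: pselect => // _ y [].
have targetS k Z : target k Z `<=` Z.
  by rewrite /target /or_else; case: pselect => /= [_ y []|_ y].
have : forall q : nat * set X, exists r, open q.2 -> q.2 !=set0 ->
    [/\ open_box r, r.1 `*` r.2 `<=` O, smX n r.1 /\ smY n r.2,
      closure r.1 `<=` target q.1 q.2 /\ closure r.2 `<=` targetY q.1 &
      (q.2 `\` closure r.1) !=set0].
  move=> [k Z] /=.
  have [oZ|?] := pselect (open Z); last by exists (set0, set0).
  have [Z0|?] := pselect (Z !=set0); last by exists (set0, set0).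
  have [||||r [r1 r2 r3 r4 [x [/targetS Zx xr]]]] :=
      @small_box n O (target k Z) (targetY k) oO dO.
  - by apply: or_elseO => //; apply: openI => //; case: bX.
  - exact: or_else0.
  - by apply: or_elseO => //; apply: openI => //; case: bY.
  - exact: or_else0.
  by exists r => _ _; split => //; exists x.
move=> /choice [h hP].
pose Z := fix Z k := if k is j.+1 then Z j `\` closure (h (j, Z j)).1 else U.
pose c k := h (k, Z k).
have ZP k : open (Z k) /\ Z k !=set0.
  elim: k => //= k [oZ Z0]; have [_ _ _ _ ?] := hP (k, Z k) oZ Z0.
  split=> //; rewrite setDE; apply: openI => //; rewrite openC.
  exact: closed_closure.
have cP k := hP (k, Z k) (ZP k).1 (ZP k).2.
have Zanti j k : (j <= k)%N -> Z k `<=` Z j.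
  move=> /subnK <-; elim: (k - j)%N => // i IH; rewrite addSn => z [Zz _].
  exact: IH.
have cZ k : closure (c k).1 `<=` Z k.
  by have [_ _ _ [h1 _] _] := cP k => z /h1 /targetS.
have disj j k x : (j < k)%N -> (c j).1 x -> (c k).1 x -> False.
  move=> jk /subset_closure cj /subset_closure /cZ /(Zanti _ _ jk) /= [_].
  exact.
exists c; split.
- move=> k; have [h1 h2 _ [_ h4] _] := cP k; split => //=.
    by move=> z /cZ /(Zanti 0%N k (leq0n k)).
  by move=> z /h4 /targetYS.
- by move=> k; have [] := cP k.
- move=> j k x cj ck; have [jk|kj|//] := ltngtP j k.
    by have := disj _ _ _ jk cj ck.
  by have := disj _ _ _ kj ck cj.
- move=> W oW WU; have [k [Ck0 CkW]] := bX.2 _ (openI oW oU) WU.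
  apply: contrapT => noW.
  have missed i : W `&` (c i).1 = set0.
    by apply/eqP; apply: contra_notT noW => /set0P; exists i.
  have Wcl i z : W z -> ~ closure (c i).1 z.
    move=> Wz /(_ W) []; first exact: open_nbhs_nbhs.
    by move=> t [ct Wt]; have : (W `&` (c i).1) t by []; rewrite missed.
  have CZ i : CX k `<=` Z i.
    elim: i => [|i IH] z Cz /=; first by case: (CkW _ Cz).
    by split; [exact: IH|apply: Wcl; case: (CkW _ Cz)].
  have [[_ [x cx] _ _] _ _ [h1 _] _] := cP k.
  have := h1 _ (subset_closure cx).
  rewrite /target /or_else setIidl; last exact: CZ.
  case: pselect => //= _ /CkW [Wx _].
  by have : (W `&` (c k).1) x by []; rewrite missed.
- move=> W oW WV; have [k [Ck0 CkW]] := bY.2 _ (openI oW oV) WV.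
  exists k; have [[_ _ _ [y cy]] _ _ [_ h1] _] := cP k.
  exists y; split=> //; have := h1 _ (subset_closure cy).
  rewrite /targetY /or_else setIA; case: pselect => /= [_ [[/CkW []]] //|no].
  case: no; apply: dE; last by apply: openI => //; case: bY.
  by have [z Cz] := Ck0; exists z; split => //; case: (CkW _ Cz).
Qed.

End Split.

(** * The tree of boxes *)

Section Tree.
Variables (X Y : topologicalType).
Variables (smX : nat -> set (set X)) (smY : nat -> set (set Y)).
Variable children : nat -> set Y -> set X * set Y -> nat -> set X * set Y.
Variable O : nat -> set (X * Y).
Hypothesis childrenP : forall n E p, open E -> dense E -> open_box p ->
  splitting (smX n) (smY n) (O n) E p (children n E p).

(** The first component gives the boxes of level [n], of which only those at
    sequences of length [n] matter; a sequence lists its last choice first, so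
    that the children of [t] are the [k :: t].  The second component remembers,
    at index [CodeSeq.code s], the conditions imposed so far on account of [s]:
    to lie in some child of [s], or outside the closure of the box of [s]. *)
Fixpoint level n : (seq nat -> set X * set Y) * (nat -> set Y) :=
  if n isn't m.+1 then (fun=> (setT, setT), fun=> setT) else
  let: (P, Q) := level m in
  let c s := children m (\bigcap_(j < m.+1) Q j) (P s) in
  (fun s => if s is k :: t then c t k else P s,
   fun j => let s := CodeSeq.decode j in
     Q j `&` ((\bigcup_k (c s k).2) `|` ~` closure (P s).2)).

Definition node s := (level (size s)).1 s.

(** Only the first [n.+1] conditions are imposed at level [n]: an intersection
    of all of them need not be open. *)
Definition allowed n := \bigcap_(j < n.+1) (level n).2 j.

Lemma dense_cover (V : set Y) (V_ : nat -> set Y) :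
  (forall W, open W -> W `&` V !=set0 -> exists k, W `&` V_ k !=set0) ->
  dense ((\bigcup_k V_ k) `|` ~` closure V).
Proof.
move=> VV_ W [w Ww] oW.
have [WV|WV] := pselect (W `&` V !=set0).
  by have [k [y [Wy Vy]]] := VV_ _ oW WV; exists y; split=> //; left; exists k.
exists w; split=> //; right => /(_ W) [|y [Vy Wy]].
  exact: open_nbhs_nbhs.
by apply: WV; exists y.
Qed.

Hypotheses (X0 : [set: X] !=set0) (Y0 : [set: Y] !=set0).

Lemma levelP n : (forall s, open_box ((level n).1 s)) /\
  (forall j, open ((level n).2 j) /\ dense ((level n).2 j)).
Proof.
elim: n => [|n] /=.
  split=> _; first by split=> //=; exact: openT.
  by split; [exact: openT|move=> W [w Ww] _; exists w].
case: (level n) => P Q /= [boxP QP].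
have [oE dE] := dense_bigcap_lt n.+1 (fun j => (QP j).1) (fun j => (QP j).2).
have cP s := childrenP n oE dE (boxP s).
split.
  by case=> [|k t]; [exact: boxP|have [cbox _ _ _ _] := cP t; case: (cbox k)].
move=> j; set s := CodeSeq.decode j; have [sbox _ _ _ sdense] := cP s.
have [oQ dQ] := QP j.
have oV : open (\bigcup_k (children n (\bigcap_(j < n.+1) Q j) (P s) k).2).
  by apply: bigcup_open => k _; have [[]] := sbox k.
have oU := openU oV (closed_openC (@closed_closure _ (P s).2)).
split; first exact: openI.
exact: denseI (dense_cover sdense).
Qed.

Lemma open_dense_allowed n : open (allowed n) /\ dense (allowed n).
Proof. by apply: dense_bigcap_lt => j; case: ((levelP n).2 j). Qed.

Lemma node_splitting s : splitting (smX (size s)) (smY (size s)) (O (size s))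
  (allowed (size s)) (node s) (fun k => node (k :: s)).
Proof.
have [oE dE] := open_dense_allowed (size s).
have := childrenP (size s) oE dE ((levelP (size s)).1 s).
by rewrite /node /allowed /=; case: (level (size s)).
Qed.

(** The condition on account of [s] is recorded when its children are chosen,
    at level [(size s).+1], and is among the first [n.+1] once [n] is at least
    the code of [s]; a point of [(node s).2] then cannot satisfy it by lying
    outside the closure. *)
Lemma node_cover s :
  exists n, allowed n `&` (node s).2 `<=` \bigcup_k (node (k :: s)).2.
Proof.
exists (maxn (size s).+1 (CodeSeq.code s)) => y [ally Vy].
have Qanti m n j : (m <= n)%N -> (level n).2 j `<=` (level m).2 j.
  move=> /subnK <-; elim: (n - m)%N => // i IH; rewrite addSn => z /= Qz.
  apply: IH; move: Qz; case: (level _) => P Q /=.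
  by case.
have : (level (size s).+1).2 (CodeSeq.code s) y.
  apply: (Qanti _ (maxn (size s).+1 (CodeSeq.code s))); first exact: leq_maxl.
  by apply: ally; rewrite /= ltnS leq_maxr.
rewrite /node /=; move: Vy; rewrite /node.
case: (level (size s)) => P Q /= Vy; rewrite CodeSeq.codeK => -[_ []//].
by case; exact: subset_closure.
Qed.

End Tree.

(** * Branches and the Baire space *)

Section Branch.

Fixpoint branch (a : nat -> nat) n : seq nat :=
  if n is m.+1 then a m :: branch a m else [::].

Lemma size_branch a n : size (branch a n) = n.
Proof. by elim: n => //= n ->. Qed.

(** A branch can be forced through [t] and be continued from there by any rule;
    [rev t] appears as [t] lists its last choice first. *)
Lemma branch_through (t : seq nat) (next : seq nat -> nat) :
  exists a, branch a (size t) = t /\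
    forall n, (size t <= n)%N -> a n = next (branch a n).
Proof.
pose pick u := if (size u < size t)%N then nth 0%N (rev t) (size u) else next u.
pose r := fix r n := if n is m.+1 then pick (r m) :: r m else [::].
pose a n := pick (r n).
have ar n : branch a n = r n by elim: n => //= n ->.
have sr n : size (r n) = n by rewrite -ar size_branch.
have aE n : (n < size t)%N -> a n = nth 0%N (rev t) n.
  by move=> nt; rewrite /a /pick sr nt.
exists a; split; last by move=> n tn; rewrite {1}/a /pick sr ltnNge tn /= ar.
elim: t {pick r ar sr} a aE => //= k t IH a aE.
rewrite aE // IH => [|n nt].
  by rewrite rev_cons nth_rcons size_rev ltnn eqxx.
by rewrite aE ?ltnS 1?ltnW // rev_cons nth_rcons size_rev nt.
Qed.

(** The sets of sequences sharing a given initial segment form a neighbourhood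
    base: a subbasic neighbourhood constrains one value [a i], hence contains
    all the sequences agreeing with [a] up to [i.+1], and conversely finitely
    many coordinates are determined by discrete conditions. *)
Lemma baire_nbhsP (a : baire_space) N :
  nbhs a N <-> exists n, forall b, branch b n = branch a n -> N b.
Proof.
pose F := filter_from [set: nat] (fun n => [set b | branch b n = branch a n]).
have branchS m n b : (m <= n)%N -> branch b n = branch a n ->
    branch b m = branch a m.
  by move=> /subnK <-; elim: (n - m)%N => // i IH; rewrite addSn /= => -[_ /IH].
have FF : Filter F.
  apply: filter_from_filter; first by exists 0%N.
  move=> m n _ _; exists (maxn m n) => // b /= bE.
  by split; apply: branchS bE; rewrite ?leq_maxl ?leq_maxr.
split=> [Na|[n nN]].
  suff /(_ _ Na) [n _ nN] : F --> a by exists n => b /nN.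
  apply/cvg_sup => i W /= [_ [[V oV <-] /= Va] VW].
  by exists i.+1 => // b /= [bi _]; apply: (VW b); rewrite /= bi.
apply: (@filterS _ _ _ [set b : baire_space | branch b n = branch a n]) => //.
elim: {nN} n => [|n IH] /=; first by apply: filterS filterT.
have : nbhs a [set b : baire_space | b n = a n].
  apply: (@proj_continuous _ (fun=> nat) n a [set a n]).
  exact: discrete_set1.
by apply: filterS2 IH => b /= -> ->.
Qed.

Variables (T : topologicalType) (small : nat -> set (set T)).
Hypotheses (aT : accessible_space T) (shT : shrinking small).

Definition cantor_scheme (U : seq nat -> set T) :=
  forall s, [/\ U s !=set0, forall k, closure (U (k :: s)) `<=` U s &
                forall k, small (size s) (U (k :: s))].

(** The sets along a branch shrink to one point, and the set at depth [n]
    depends on an initial segment of the branch only, whence continuity. *)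
Lemma cantor_scheme_point (U : seq nat -> set T) : cantor_scheme U ->
  exists p : baire_space -> T,
    [/\ continuous p, forall a n, U (branch a n) (p a),
        forall a W, nbhs (p a) W -> exists n, U (branch a n) `<=` W &
        forall a x, (forall n, U (branch a n) x) -> p a = x].
Proof.
move=> UP.
have : forall a : nat -> nat, exists x, (forall n, U (branch a n) x) /\
    forall W, nbhs x W -> exists n, U (branch a n) `<=` W.
  move=> a; apply: shT.2 => n.
  - by case: (UP (branch a n)).
  - by case: (UP (branch a n)) => _ + _; exact.
  - by case: (UP (branch a n)) => _ _ /(_ (a n)); rewrite size_branch.
move=> /choice [p pP]; exists p; split.
- move=> a W /(pP a).2 [n nW]; apply/baire_nbhsP; exists n => b ban.
  by apply: nW; rewrite -ban; apply: (pP b).1.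
- by move=> a; exact: (pP a).1.
- by move=> a; exact: (pP a).2.
- move=> a x Ux; apply: contrapT => /eqP /aT [W [oW /set_mem Wp /set_mem]].
  have [|n nW] := (pP a).2 W; first exact: open_nbhs_nbhs.
  by case; exact: nW.
Qed.

End Branch.

(** * Coding the points of a disjoint scheme *)

Section Coding.
Variables (T : topologicalType) (U : seq nat -> set T).
Hypotheses (U_open : forall s, open (U s))
  (U_nested : forall s k, U (k :: s) `<=` U s)
  (U_disj : forall s j k x, U (j :: s) x -> U (k :: s) x -> j = k).

Definition branch_set := \bigcap_n \bigcup_(s in [set s | size s = n]) U s.

Lemma same_level s t x : size s = size t -> U s x -> U t x -> s = t.
Proof.
elim: s t => [|j s IH] [|k t] //= [st] Us Ut.
have {}st : s = t by apply: IH st _ _; [exact: U_nested Us|exact: U_nested Ut].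
by rewrite st in Us *; rewrite (U_disj Us Ut).
Qed.

Lemma same_branch a b x : (forall n, U (branch a n) x) ->
  (forall n, U (branch b n) x) -> a = b.
Proof.
move=> ax bx; apply/funext => n.
have : branch a n.+1 = branch b n.+1.
  by apply: same_level (ax _) (bx _); rewrite !size_branch.
by case.
Qed.

(** The nodes of the various levels that contain [x] are unique by
    disjointness, so they fit together into a branch. *)
Lemma branch_setP x : branch_set x <-> exists a, forall n, U (branch a n) x.
Proof.
split=> [Fx|[a ax] n _]; last by exists (branch a n); rewrite /= ?size_branch.
have /choice [s sP] : forall n, exists s, size s = n /\ U s x.
  by move=> n; have [s ? ?] := Fx n I; exists s.
exists (fun n => head 0%N (s n.+1)) => n.
suff -> : branch (fun n => head 0%N (s n.+1)) n = s n by case: (sP n).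
elim: n => [|n /= ->]; first by case: (s 0%N) (sP 0%N).1.
have [] := sP n.+1; case: (s n.+1) => //= k t [st] Ut; congr cons.
apply: (@same_level _ _ x); first by rewrite st; case: (sP n).
  by case: (sP n).
exact: U_nested Ut.
Qed.

(** The first [n] values of the code are constant on the open set [U s] for
    [s] of length [n], so the code is continuous. *)
Lemma coding_exists : exists code : set_type branch_set -> baire_space,
  continuous code /\ forall x n, U (branch (code x) n) (set_val x).
Proof.
have /choice [code codeP] : forall x : set_type branch_set,
    exists a : baire_space, forall n, U (branch a n) (set_val x).
  by move=> x; apply/branch_setP; case: x => x; rewrite set_valE /= => /set_mem.
exists code; split=> // x W /baire_nbhsP [n nW].
have : nbhs x (set_val @^-1` U (branch (code x) n)).
  by apply: initial_continuous; apply: open_nbhs_nbhs; split.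
apply: filterS => z Uz; apply: nW.
by apply: same_level Uz; rewrite ?size_branch.
Qed.

End Coding.

(** * The open surjection *)

(* [set_type F] and [set_type G] carry the subspace topologies. *)
Theorem mainTheorem7 (R : realType) (X Y : topologicalType)
    (X0 : [set: X] !=set0) (Y0 : [set: Y] !=set0)
    (polX : polish R X) (polY : polish R Y) (perfX : perfect_space X)
    (A : set (X * Y)%type) (dGA : dense_Gdelta A) :
  exists (F : set X) (G : set Y) (f : set_type F -> set_type G),
    dense_Gdelta F /\ dense_Gdelta G /\
    [/\ continuous f, open_map f &
        set_surj [set: set_type F] [set: set_type G] f] /\
    (forall x : set_type F, A (set_val x, set_val (f x))) /\
    homeomorphic (set_type F) baire_space.
Proof.
have [aX [smX shX] [CX bX]] := polish_shrinking polX.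
have [aY [smY shY] [CY bY]] := polish_shrinking polY.
have [dA [A_ oA AE]] := dGA.
have dA_ n : dense (A_ n).
  move=> W W0 oW; have [z [Wz Az]] := dA _ W0 oW; exists z; split=> //.
  by move: Az; rewrite AE; exact.
have : forall r : nat * set Y * (set X * set Y), exists c,
    open r.1.2 -> dense r.1.2 -> open_box r.2 ->
    splitting (smX r.1.1) (smY r.1.1) (A_ r.1.1) r.1.2 r.2 c.
  move=> [[n E] p] /=.
  have [oE|?] := pselect (open E); last by exists (fun=> p).
  have [dE|?] := pselect (dense E); last by exists (fun=> p).
  have [op|?] := pselect (open_box p); last by exists (fun=> p).
  have [c cP] := splitting_exists shX shY aX perfX bX bY n
    (oA n) (dA_ n) oE dE op.
  by exists c.
move=> /choice [h hP].
have splitP n E p : open E -> dense E -> open_box p ->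
    splitting (smX n) (smY n) (A_ n) E p (h (n, E, p)) := hP (n, E, p).
pose B s := node (fun n E p => h (n, E, p)) s.
pose E n := allowed (fun n E p => h (n, E, p)) n.
have BP s := node_splitting splitP X0 Y0 s.
have box s : open_box (B s) := (levelP splitP X0 Y0 (size s)).1 s.
have EP n : open (E n) /\ dense (E n) := open_dense_allowed splitP X0 Y0 n.
have cover s : exists n, E n `&` (B s).2 `<=` \bigcup_k (B (k :: s)).2
  by exact: node_cover.
pose U s := (B s).1; pose V s := (B s).2.
have U_open s : open (U s) by case: (box s).
have V_open s : open (V s) by case: (box s).
have U_nested s k : U (k :: s) `<=` U s.
  have [/(_ k) [_ _ h1 _] _ _ _ _] := BP s.
  by move=> x /subset_closure /h1.
have V_nested s k : V (k :: s) `<=` V s `&` E (size s).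
  have [/(_ k) [_ _ _ h1] _ _ _ _] := BP s.
  by move=> y /subset_closure /h1.
have U_disj s j k x : U (j :: s) x -> U (k :: s) x -> j = k.
  by have [_ _ disj _ _] := BP s; exact: disj.
have U_scheme : cantor_scheme smX U.
  move=> s; have [h1 h2 _ _ _] := BP s; split; first by case: (box s).
    by move=> k; case: (h1 k).
  by move=> k; case: (h2 k).
have V_scheme : cantor_scheme smY V.
  move=> s; have [h1 h2 _ _ _] := BP s; split; first by case: (box s).
    by move=> k; case: (h1 k) => _ _ _ h3 y /h3 [].
  by move=> k; case: (h2 k).
have [p [p_cont pU pW p_uniq]] := cantor_scheme_point aX shX U_scheme.
have [q [q_cont qV _ q_uniq]] := cantor_scheme_point aY shY V_scheme.
pose F := branch_set U; pose G := \bigcap_n E n.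
have [code [code_cont codeU]] := coding_exists U_open U_nested U_disj.
have pF a : p a \in F.
  by apply/mem_set/(branch_setP U_nested U_disj); exists a.
have qG a : q a \in G.
  by apply/mem_set => n _; have [_] := V_nested _ _ _ (qV a n.+1);
    rewrite size_branch.
pose phi a : set_type F := exist _ (p a) (pF a).
pose f (x : set_type F) : set_type G := exist _ (q (code x)) (qG (code x)).
have p_code x : p (code x) = set_val x by apply: p_uniq.
have code_phi a : code (phi a) = a.
  exact: (same_branch U_nested U_disj (codeU (phi a)) (pU a)).
(* A point of [G `&` V s] stays in some child forever, so it is the image of a
   branch through [s]; this is what makes [f] open and onto. *)
have through s y : V s y -> G y -> exists a, branch a (size s) = s /\ q a = y.
  move=> Vy Gy.
  have /choice [next nextP] : forall s, exists k, V s y -> V (k :: s) y.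
    move=> t; have [Vt|?] := pselect (V t y); last by exists 0%N.
    have [n /(_ y) []] := cover t; first by split=> //; exact: Gy.
    by move=> k; exists k.
  have [a [as_s aN]] := branch_through s next.
  exists a; split=> //; apply: q_uniq => n.
  have Vle m : V (branch a (size s + m)) y.
    elim: m => [|m IH]; first by rewrite addn0 as_s.
    by rewrite addnS /= aN ?leq_addr //; exact: nextP.
  have [sn|/ltnW ns] := leqP (size s) n; first by rewrite -(subnKC sn).
  have := Vle 0%N; rewrite addn0 -(subnK ns).
  by elim: (size s - n)%N => // i IH; rewrite addSn => /V_nested [/IH].
exists F, G, f; split; [|split; [|split; [split|split]]].
- split; last first.
    exists (fun n => \bigcup_(s in [set s | size s = n]) U s) => // n.
    exact: bigcup_open.
  apply: (shrinking_baire shX) => [n|]; first exact: bigcup_open.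
  elim=> [|n IH] W W0 oW.
    have [w Ww] := W0; exists w; split=> //.
    by exists [::].
  have [x [Wx [s sn Ux]]] := IH W W0 oW.
  have [_ _ _ + _] := BP s => /(_ W oW) [|k [z [Wz Uz]]]; first by exists x.
  by exists z; split=> //; exists (k :: s) => //=; rewrite sn.
- split; last by exists E => // n; case: (EP n).
  by apply: (shrinking_baire shY) => n; case: (EP n).
- apply: continuous_comp_initial => x.
  exact: (continuous_comp (code_cont x) (q_cont (code x))).
(* The image of [W] is the trace on [G] of the union of the [V s] over the nodes
   with [U s `<=` W]. *)
- move=> _ [W oW <-]; exists (\bigcup_(s in [set s | U s `<=` W]) V s).
    exact: bigcup_open.
  apply/seteqP; split=> [y [s sW Vy]|_ [x Wx <-]] /=.
    have [|a [as_s qa]] := through _ _ Vy; first by apply/set_mem; case: y {Vy}.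
    exists (phi a); first by apply: sW; rewrite -as_s; exact: pU.
    by apply/val_inj; rewrite /= code_phi.
  have [|n nW] := pW (code x) W.
    by rewrite p_code; apply: open_nbhs_nbhs.
  by exists (branch (code x) n) => //; exact: qV.
- move=> y _; have [||a [_ qa]] := through [::] (set_val y).
  + by [].
  + by apply/set_mem; case: y.
  by exists (phi a) => //; apply/val_inj; rewrite /= code_phi.
- move=> x; rewrite AE => n _.
  have [/(_ (code x n)) [_ + _ _] _ _ _ _] := BP (branch (code x) n).
  rewrite size_branch; apply; split; last exact: (qV (code x) n.+1).
  exact: (codeU x n.+1).
- exists code, phi; split=> //.
    by apply: continuous_comp_initial => a; exact: p_cont.
  by move=> x; apply/val_inj; rewrite /= p_code.
Qed.
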